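(* Let $S_n=K_{1,n-1}$ be the star of order $n$, where $n\geq 3$. Then $\mathrm{fgndi}_{\sum}(S_n)=1$.
   Context: For a finite simple graph $G$ and an integer $k\ge 1$, a non-proper total $k$-coloring is an arbitrary map $f: V(G)\cup E(G)\rightarrow \{1,2,\dots,k\}$. Its weight function is $$\phi(x)=f(x)+\sum_{e\ni x}f(e)+\sum_{y\in N(x)}f(y)\quad (x\in V(G)),$$ where the first sum is over the edges $e$ incident with $x$ and $N(x)=\{y\in V(G): xy\in E(G)\}$. The coloring $f$ is called a neighbor full sum distinguishing (NFSD) total $k$-coloring if $\phi(x)\neq\phi(y)$ for every edge $xy\in E(G)$. The neighbor full sum distinguishing total chromatic number $\mathrm{fgndi}_{\sum}(G)$ is the smallest $k$ for which $G$ has an NFSD total $k$-coloring. *)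

(* Defs.v *)
From mathcomp Require Import all_boot.
Set Implicit Arguments.
Unset Strict Implicit.
Unset Printing Implicit Defensive.

Record sgraph := SGraph {
  vertex :> finType;
  adj : rel vertex;
  adj_sym : symmetric adj;
  adj_irrefl : irreflexive adj
}.

Definition edge_set (G : sgraph) : {set {set G}} :=
  [set [set p.1; p.2] | p : G * G & adj p.1 p.2].

Definition edge (G : sgraph) := {e : {set G} | e \in edge_set G}.

(* A map on the disjoint union of V(G) and E(G); the colors are kept as
   natural numbers, since the weights add them up. *)
Definition total_coloring (G : sgraph) (k : nat) (f : G + edge G -> nat) : Prop :=
  forall z, 1 <= f z <= k.

Definition weight (G : sgraph) (f : G + edge G -> nat) (x : G) : nat :=
  f (inl x) + \sum_(e : edge G | x \in val e) f (inr e)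
            + \sum_(y : G | adj x y) f (inl y).

Definition nfsd_coloring (G : sgraph) (k : nat) (f : G + edge G -> nat) : Prop :=
  total_coloring k f /\ forall x y : G, adj x y -> weight f x <> weight f y.

Definition nfsd_colorable (G : sgraph) (k : nat) : Prop :=
  1 <= k /\ exists f : G + edge G -> nat, nfsd_coloring k f.

(* [is_fgndi G k] says that the neighbor full sum distinguishing total
   chromatic number of [G] exists and equals [k].  It is a relation because
   the number need not exist: the two ends of an isolated edge always have the
   same weight. *)
Definition is_fgndi (G : sgraph) (k : nat) : Prop :=
  nfsd_colorable G k /\ forall j, nfsd_colorable G j -> k <= j.

Section CompleteBipartite.
Variables m n : nat.

Definition biadj : rel ('I_m + 'I_n) := fun x y =>
  match x, y with
  | inl _, inr _ | inr _, inl _ => true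
  | _, _ => false
  end.

Lemma biadj_sym : symmetric biadj.
Proof. by case=> ? []. Qed.

Lemma biadj_irrefl : irreflexive biadj.
Proof. by case. Qed.

Definition complete_bipartite : sgraph := SGraph biadj_sym biadj_irrefl.

End CompleteBipartite.

Definition star (n : nat) : sgraph := complete_bipartite 1 n.-1.

(* Main.v *)
Require Import Defs.
From mathcomp Require Import all_boot.

(** Color every vertex and every edge by 1. A vertex [x] then has weight
    [1 + 2 deg x]: it contributes 1 itself, and each neighbor contributes once
    as a vertex and once through the edge joining it to [x]
    ([card_incident_edges]). So one color suffices for every graph in which
    adjacent vertices have different degrees ([is_fgndi_1]), and in a star with
    at least two leaves the center has degree at least 2 while each leaf has
    degree 1. *)

Lemma edge_setP (G : sgraph) (e : {set G}) :
  reflect (exists x y : G, adj x y /\ e = [set x; y]) (e \in edge_set G).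
Proof.
apply: (iffP imsetP) => [[[x y]] /[!inE] /= xy -> | [x [y [xy ->]]]].
  by exists x, y.
by exists (x, y); rewrite ?inE.
Qed.

(** The other endpoint determines the edge and is determined by it, because the
    graph is simple: [y |-> [set x; y]] is a bijection from the neighbors of
    [x] to the edges at [x]. *)
Lemma card_incident_edges (G : sgraph) (x : G) :
  #|[set e : edge G | x \in val e]| = #|[set y | adj x y]|.
Proof.
rewrite -(card_imset _ val_inj).
have -> : val @: [set e : edge G | x \in val e]
        = [set [set x; y] | y in [set y | adj x y]].
  apply/setP => e; apply/imsetP/imsetP => [[e' xe' ->] | [y xy ->]].
    have [u [v [uv def_e]]] := edge_setP _ _ (valP e').
    move: xe'; rewrite inE def_e in_set2 => /orP[] /eqP ->.
      by exists v; rewrite ?inE.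
    by exists u; rewrite 1?setUC // inE adj_sym.
  rewrite inE in xy.
  have xyE : [set x; y] \in edge_set G by apply/edge_setP; exists x, y.
  by exists (Sub [set x; y] xyE); rewrite ?inE /= ?eqxx.
rewrite card_in_imset // => y z; rewrite !inE => xy _ eq_xy_xz.
have: y \in [set x; z] by rewrite -eq_xy_xz set22.
rewrite in_set2 => /orP[/eqP yx | /eqP //].
by move: xy; rewrite yx adj_irrefl.
Qed.

Lemma weight_const1 (G : sgraph) (x : G) :
  weight (fun _ : G + edge G => 1) x = 1 + #|[set y | adj x y]|.*2.
Proof. by rewrite /weight !sum1dep_card card_incident_edges -addnA addnn. Qed.

Lemma is_fgndi_1 (G : sgraph) :
  (forall x y : G, adj x y -> #|[set z | adj x z]| <> #|[set z | adj y z]|) ->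
  is_fgndi G 1.
Proof.
move=> deg_neq; split; last by move=> j [].
split=> //; exists (fun _ => 1); split=> // x y /deg_neq deg_xy.
by rewrite !weight_const1 => /addnI /double_inj.
Qed.

Lemma card_adj_inl (m n : nat) (i : 'I_m) :
  #|[set z | @adj (complete_bipartite m n) (inl i) z]| = n.
Proof.
have -> : [set z | @adj (complete_bipartite m n) (inl i) z] = inr @: [set: 'I_n].
  apply/setP => -[a | b]; rewrite inE /=; last by rewrite imset_f.
  by apply/esym/imsetP => -[].
by rewrite card_imset ?cardsT ?card_ord // => a b [].
Qed.

Lemma card_adj_inr (m n : nat) (j : 'I_n) :
  #|[set z | @adj (complete_bipartite m n) (inr j) z]| = m.
Proof.
have -> : [set z | @adj (complete_bipartite m n) (inr j) z] = inl @: [set: 'I_m].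
  apply/setP => -[a | b]; rewrite inE /=; first by rewrite imset_f.
  by apply/esym/imsetP => -[].
by rewrite card_imset ?cardsT ?card_ord // => a b [].
Qed.

Theorem proposition8 (n : nat) (hn : 3 <= n) : is_fgndi (star n) 1.
Proof.
have leaves_neq1 : n.-1 <> 1 by case: n hn => [|[|[|n]]].
by apply: is_fgndi_1 => -[i | i] [j | j] // _;
  rewrite card_adj_inl card_adj_inr // => /esym.
Qed.
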